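(* The Hilbert lattice $\overline{\mathbb{Z}}$ of algebraic integers is indecomposable. That is, $\overline{\mathbb{Z}}\neq 0$, and for all subgroups $\Lambda_1,\Lambda_2\subseteq\overline{\mathbb{Z}}$ such that $\langle \Lambda_1,\Lambda_2\rangle=0$ and the natural map $\Lambda_1\oplus\Lambda_2\to\overline{\mathbb{Z}}$ is an isomorphism of abelian groups, one has $\Lambda_1=0$ or $\Lambda_2=0$.
   Context: $\overline{\mathbb{Q}}$ is an algebraic closure of $\mathbb{Q}$ and $\overline{\mathbb{Z}}\subseteq\overline{\mathbb{Q}}$ is the ring of algebraic integers. $\overline{\mathbb{Q}}$ carries the inner product $$\langle\alpha,\beta\rangle=\frac{1}{[\mathbb{Q}(\alpha,\beta):\mathbb{Q}]}\sum_{\sigma:\mathbb{Q}(\alpha,\beta)\to\mathbb{C}}\sigma(\alpha)\cdot\overline{\sigma(\beta)},$$ where the sum ranges over all field embeddings of $\mathbb{Q}(\alpha,\beta)$ in $\mathbb{C}$, and $q(\alpha)=\langle\alpha,\alpha\rangle$. A Hilbert lattice is an abelian group $\Lambda$ with a map $q:\Lambda\to\mathbb{R}$ (its square-norm) satisfying the parallelogram law $q(x+y)+q(x-y)=2q(x)+2q(y)$ for all $x,y\in\Lambda$ and such that there is $r\in\mathbb{R}_{>0}$ with $q(x)\geq r$ for all non-zero $x\in\Lambda$; its inner product is $\langle x,y\rangle=\frac12(q(x+y)-q(x)-q(y))$. The group $\overline{\mathbb{Z}}$ with the square-norm $q(\alpha)=\langle\alpha,\alpha\rangle$ is a Hilbert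 lattice, with inner product the restriction to $\overline{\mathbb{Z}}$ of the inner product $\langle\alpha,\beta\rangle=\frac{1}{[\mathbb{Q}(\alpha,\beta):\mathbb{Q}]}\sum_{\sigma:\mathbb{Q}(\alpha,\beta)\to\mathbb{C}}\sigma(\alpha)\cdot\overline{\sigma(\beta)}$ on $\overline{\mathbb{Q}}$. *)

(* Defs.v *)
From HB Require Import structures.
From mathcomp Require Import all_boot all_order all_algebra all_field.
From mathcomp Require Import boolp classical_sets functions fsbigop reals.
From mathcomp Require Import complex.

Set Implicit Arguments.
Unset Strict Implicit.
Unset Printing Implicit Defensive.

Import Order.TTheory GRing.Theory Num.Theory.
Local Open Scope classical_set_scope.
Local Open Scope ring_scope.

(* [algC] serves as the algebraic closure of the rationals.  For algebraic    *)
(* [alpha] and [beta], [num_field_exists] provides an abstract number field,  *)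
(* an embedding of it in [algC], and preimages of [alpha] and [beta] that     *)
(* generate it over [rat]: it is an isomorphic copy of Q(alpha, beta).        *)
Section NumberField.
Variables alpha beta : algC.
Let nf := num_field_exists [:: alpha; beta].

Definition Qadjoin2 : fieldExtType rat := projT1 nf.
Definition Qadjoin2_fst : Qadjoin2 := (s2val (projT2 (projT2 nf)))`_0.
Definition Qadjoin2_snd : Qadjoin2 := (s2val (projT2 (projT2 nf)))`_1.
End NumberField.

(* Embeddings are taken as bare functions, so that summing over this set      *)
(* counts each of them once.                                                  *)
Definition embeddings (R : realType) (F : fieldExtType rat) : set (F -> R[i]) :=
  [set s : F -> R[i] | exists f : {rmorphism F -> R[i]}, s = f :> (F -> R[i])].
Arguments embeddings R F : clear implicits.

(* The set of embeddings is finite, so this [\sum_(_ \in _)] is a genuine     *)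
(* finite sum and not the default value 0 given to infinite supports.         *)
Definition inner (R : realType) (alpha beta : algC) : R[i] :=
  (\dim {: Qadjoin2 alpha beta})%:R^-1 *
  \sum_(s \in embeddings R (Qadjoin2 alpha beta))
     (s (Qadjoin2_fst alpha beta) * Num.conj (s (Qadjoin2_snd alpha beta))).
Arguments inner R alpha beta : clear implicits.

Record Zbar := MkZbar { Zbar_val :> algC; _ : Zbar_val \in Aint }.
HB.instance Definition _ := [isSub for Zbar_val].
HB.instance Definition _ := [Choice of Zbar by <:].
HB.instance Definition _ := [SubChoice_isSubZmodule of Zbar by <:].

Section Indecomposable.
Variables (L : zmodType) (K : nmodType) (ip : L -> L -> K).

Definition orthogonal_subgroups (L1 L2 : zmodClosed L) : Prop :=
  {in L1 & L2, forall x y, ip x y = 0}.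

Definition sum_map (L1 L2 : zmodClosed L)
    (u : {x : L | x \in L1} * {x : L | x \in L2}) : L :=
  val u.1 + val u.2.

(* [sum_map] is additive, so it is an isomorphism of groups as soon as it is  *)
(* bijective.                                                                 *)
Definition indecomposable : Prop :=
  (exists x : L, x != 0) /\
  forall L1 L2 : zmodClosed L,
    orthogonal_subgroups L1 L2 -> bijective (@sum_map L1 L2) ->
    {in L1, forall x, x = 0} \/ {in L2, forall x, x = 0}.
End Indecomposable.

(* Main.v *)
Require Import Defs.
From HB Require Import structures.
From mathcomp Require Import all_boot all_order all_algebra all_field.
From mathcomp Require Import boolp classical_sets functions fsbigop reals.
From mathcomp Require Import complex ring.

(** Write [q] for the square-norm.  By the inequality of arithmetic and geometric
    means and because norms of nonzero algebraic integers are nonzero integers,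
    [q x >= 1] for every nonzero [x] in Zbar ([sq_norm_ge1]).  Suppose that Zbar
    is the orthogonal sum of [L1] and [L2].  An element [b] with [q b < 2] has at
    most one nonzero component, so it lies in [L1] or in [L2]
    ([small_in_summand]).  This applies to [1], say [1] is in [L1].

    Let [a] be a nonzero element of [L2].  It suffices to find [b] in Zbar with
    [q b < 2] that is orthogonal neither to [1] nor to [a]: being small, [b] is
    in [L1] or in [L2], and each possibility contradicts orthogonality.  A root
    of [X^n - 2(1 + a)X^(n-1) - 2] is such a [b] when [n] is a large prime.

    - The polynomial is irreducible over Q(a).  Indeed [b^n = 2u], where [u]
      turns out to be a unit of Zbar ([Aint_trinomial_unit]).  Taking norms to
      Q from Q(b), a field which contains [a], shows that [n] divides
      [Q(b) : Q] ([degree_trinomial_root]).  The degree of [a] divides it too,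
      and is smaller than the prime [n]; hence the conjugates of [b] are exactly
      the roots of the trinomials attached to the conjugates of [a]
      ([conjugates_trinomial_root]).
    - The trace of [b] over Q(a) is [2(1 + a)].  Hence [<b, z>] equals
      [2/n * <1 + a, z>] for [z] in Q(a).  As [<1, a> = 0], this is [2/n] for
      [z = 1] and [2/n * q a] for [z = a], neither of which is zero
      ([trace_trinomial_neq0], [pairing_trinomial_neq0]).
    - The sum of the squared absolute values of the roots of a monic polynomial
      of degree [n] is at most [n - 1] plus the sum of those of the nonleading
      coefficients, by Schur's inequality for the companion matrix
      ([sum_sq_roots_le]).  So [q b <= 1 + O(1/n)] ([sq_norm_trinomial_lt2]).

    The inner product of two elements is defined in the field that these two
    generate, so comparing different pairs requires that normalised sums over
    embeddings do not change when the field grows.  This is [conj_mean_embs],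
    a consequence of [perm_embs]: the embeddings of a number field restrict to
    each embedding of a subfield equally often. *)

Set Implicit Arguments.
Unset Strict Implicit.
Unset Printing Implicit Defensive.

Import Order.TTheory GRing.Theory Num.Theory.
Local Open Scope ring_scope.

(** * Conjugates and embeddings of number fields *)

Lemma sum_count_mem (T : eqType) (c s : seq T) :
  uniq c -> {subset s <= c} -> (\sum_(w <- c) count_mem w s)%N = size s.
Proof.
move=> uc sub; rewrite -sum1_size.
rewrite [RHS](eq_big_seq (fun v => \sum_(w <- c) (w == v))%N).
  rewrite exchange_big; apply: eq_bigr => w _.
  rewrite -sum1_count big_mkcond; apply: eq_bigr => v _ /=.
  by rewrite eq_sym; case: eqP.
move=> v /sub vc; rewrite -big_mkcond sum1_count /=.
by rewrite count_uniq_mem // vc.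
Qed.

Lemma sum_nat_const_seq (T : Type) (c : seq T) m :
  (\sum_(w <- c) m)%N = (size c * m)%N.
Proof. by rewrite big_const_seq count_predT iter_addn_0 mulnC. Qed.

Notation QtoF := (map_poly ratr).

Lemma rmorph_horner_rat (F : fieldExtType rat) (K : numFieldType)
    (f : {rmorphism F -> K}) p x :
  f (map_poly (in_alg F) p).[x] = (QtoF p).[f x].
Proof.
rewrite -horner_map -map_poly_comp; congr (_.[_]).
by apply: eq_map_poly => a /=; rewrite alg_num_field fmorph_rat.
Qed.

Lemma adjoin1_polyP (F : fieldExtType rat) (x y : F) :
  y \in <<1; x>>%VS -> {p : {poly rat} | y = (map_poly (in_alg F) p).[x]}.
Proof. by move=> /Fadjoin1_polyP/cid. Qed.

Section Conjugates.
Variable C : numClosedFieldType.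

Definition rat_minpoly (a : algC) : {poly rat} := s2val (minCpolyP a).

Lemma rat_minpolyE a : minCpoly a = QtoF (rat_minpoly a).
Proof. by rewrite /rat_minpoly; case: minCpolyP => p []. Qed.

Lemma rat_minpoly_monic a : rat_minpoly a \is monic.
Proof. by rewrite /rat_minpoly; case: minCpolyP => p []. Qed.

Lemma root_rat_minpoly a q : root (QtoF q) a = (rat_minpoly a %| q).
Proof. by rewrite /rat_minpoly; case: minCpolyP => p []. Qed.

Lemma size_rat_minpoly a : (1 < size (rat_minpoly a))%N.
Proof. by rewrite -(size_map_poly (ratr : rat -> algC)) -rat_minpolyE size_minCpoly. Qed.

Definition conjugates (a : algC) : seq C :=
  sval (closed_field_poly_normal (QtoF (rat_minpoly a))).

Lemma conjugatesE a :
  QtoF (rat_minpoly a) = \prod_(w <- conjugates a) ('X - w%:P).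
Proof.
rewrite /conjugates; case: closed_field_poly_normal => r /= {1}->.
by rewrite (monicP _) ?scale1r // map_monic rat_minpoly_monic.
Qed.

Lemma mem_conjugates a w :
  (w \in conjugates a) = root (QtoF (rat_minpoly a)) w.
Proof. by rewrite conjugatesE root_prod_XsubC. Qed.

Lemma size_conjugates a : size (conjugates a) = (size (rat_minpoly a)).-1.
Proof.
by rewrite -(size_map_poly (ratr : rat -> C)) conjugatesE size_prod_XsubC.
Qed.

Lemma size_conjugates_gt0 a : (0 < size (conjugates a))%N.
Proof. by rewrite size_conjugates -subn1 subn_gt0 size_rat_minpoly. Qed.

(** The gcd of the minimal polynomial [p] and its derivative has [p] as a
    multiple, so by minimality it is [1] or has [a] as a root; the degree of the
    derivative excludes the latter. *)
Lemma conjugates_uniq a : uniq (conjugates a).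
Proof.
rewrite -separable_prod_XsubC -conjugatesE separable_map.
have p_neq0 : rat_minpoly a != 0 by rewrite monic_neq0 ?rat_minpoly_monic.
rewrite separable_poly.unlock; set p := rat_minpoly a in p_neq0 *.
have sp : (1 < size p)%N := size_rat_minpoly a.
have dp_neq0 : p^`() != 0.
  rewrite -size_poly_eq0 -lt0n.
  have -> : size p^`() = (size p).-1.
    have sd : (size p).-1 = (size p).-2.+1.
      by rewrite prednK // -subn1 subn_gt0.
    rewrite /deriv sd size_poly_eq // -sd -lead_coefE.
    by rewrite (monicP (rat_minpoly_monic a)) pnatr_eq0 sd.
  by rewrite -subn1 subn_gt0.
rewrite /coprimep; apply: contraT => sg.
have [q Eq] := dvdpP _ _ (dvdp_gcdl p p^`()).
have pa : root (QtoF p) a by rewrite root_rat_minpoly.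
have g_neq0 : gcdp p p^`() != 0 by rewrite gcdp_eq0 negb_and p_neq0.
have q_neq0 : q != 0 by apply: contraNneq p_neq0 => q0; rewrite Eq q0 mul0r.
have := pa; rewrite Eq rmorphM rootM !root_rat_minpoly => /orP[] pd.
  have := dvdp_leq q_neq0 pd; rewrite -/p Eq size_mul //.
  by move: sg g_neq0; rewrite -size_poly_eq0; case: (size _) => [|[|k]] //;
     rewrite addnS /= addnS ltnNge leq_addr.
have := dvdp_leq dp_neq0 (dvdp_trans pd (dvdp_gcdr _ _)).
by rewrite leqNgt lt_size_deriv.
Qed.

End Conjugates.

Section Embeddings.
Variables (C : numClosedFieldType) (F : fieldExtType rat).
Variable phi : {rmorphism F -> algC}.
Local Notation inF := (map_poly (in_alg F)).

Lemma minPoly_rat x :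
  minPoly 1 x = map_poly (in_alg F) (rat_minpoly (phi x)).
Proof.
apply/eqP; rewrite -eqp_monic ?monic_minPoly //; last first.
  by rewrite map_monic rat_minpoly_monic.
apply/andP; split.
  apply: minPoly_dvdp; first exact: alg_polyOver.
  rewrite /root -(fmorph_eq0 phi) rmorph_horner_rat -/(root _ _).
  by rewrite root_rat_minpoly.
have /polyOver1P[q Eq] := minPolyOver 1%AS x.
rewrite Eq dvdp_map -root_rat_minpoly /root -rmorph_horner_rat -Eq.
by have /rootP-> := root_minPoly 1%AS x; rewrite rmorph0.
Qed.

Lemma size_conjugates_dim x : size (conjugates C (phi x)) = \dim <<1; x>>.
Proof.
rewrite size_conjugates -(size_map_poly (in_alg F)) -minPoly_rat.
by rewrite size_minPoly dim_Fadjoin dimv1 muln1.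
Qed.

Lemma embedding_conj (s : {rmorphism F -> C}) x :
  s x \in conjugates C (phi x).
Proof.
rewrite mem_conjugates /root -rmorph_horner_rat fmorph_eq0 -(fmorph_eq0 phi).
by rewrite rmorph_horner_rat -/(root _ _) root_rat_minpoly.
Qed.

Lemma primitive_element : {t : F | <<1; t>>%VS = fullv}.
Proof.
exists (separable_generator 1%AS {:F}%AS).
apply/esym/eq_adjoin_separable_generator; rewrite ?subvf //.
apply/separableP => y _; apply: pcharf0_separable => p.
rewrite (fmorph_pchar (in_alg F)); exact: pchar_num.
Qed.

(** Elements are polynomials in the generator [t], and evaluating these at [w]
    instead is well defined because the minimal polynomial of [t] kills [w]. *)
Lemma embedding_exists t w : <<1; t>>%VS = fullv -> w \in conjugates C (phi t) ->
  exists f : {rmorphism F -> C}, f t = w.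
Proof.
move=> gt wt.
have mt y : y \in <<1; t>>%VS by rewrite gt memvf.
pose P y := sval (adjoin1_polyP (mt y)).
have PK y : (inF (P y)).[t] = y by rewrite /P; case: adjoin1_polyP.
pose f y := (QtoF (P y)).[w].
have f_eq p y : (inF p).[t] = y -> f y = (QtoF p).[w].
  move=> E; apply/eqP; rewrite -subr_eq0 /f -hornerN -hornerD -rmorphN -rmorphD.
  have /dvdpP[q ->] : rat_minpoly (phi t) %| P y - p.
    rewrite -root_rat_minpoly /root -rmorph_horner_rat fmorph_eq0.
    by rewrite rmorphB hornerD hornerN PK E subrr.
  rewrite rmorphM hornerM; move: wt; rewrite mem_conjugates => /rootP->.
  by rewrite mulr0.
have f_add : zmod_morphism f.
  move=> x y; rewrite (f_eq (P x - P y)) ?rmorphB ?hornerD ?hornerN //.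
  by rewrite /= !PK.
have f_mul : monoid_morphism f.
  split; first by rewrite (f_eq 1) ?rmorph1 ?hornerC.
  move=> x y; rewrite (f_eq (P x * P y)) ?rmorphM ?hornerM //.
  by rewrite /= !PK.
pose fA := GRing.isZmodMorphism.Build F C f f_add.
pose fM := GRing.isMonoidMorphism.Build F C f f_mul.
pose fR : {rmorphism F -> C} := HB.pack f fA fM.
exists fR; rewrite /= (f_eq 'X) ?map_polyX ?hornerX //.
Qed.

Lemma embeddings_seq : {r : seq (F -> C) |
  [/\ uniq r, size r = \dim {: F} &
      forall s, s \in r <-> exists f : {rmorphism F -> C}, s = f]}.
Proof.
have [t gt] := primitive_element.
have ext w : {f : F -> C | w \in conjugates C (phi t) ->
   f t = w /\ exists g : {rmorphism F -> C}, f = g}.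
  apply: cid; have [wt|_] := boolP (w \in conjugates C (phi t)).
    by have [f ft] := embedding_exists gt wt; exists f => _; split=> //; exists f.
  by exists (fun=> 0).
pose e w := sval (ext w).
have et w : w \in conjugates C (phi t) -> e w t = w.
  by rewrite /e; case: (ext w) => f /= h /h[].
exists [seq e w | w <- conjugates C (phi t)]; split.
- rewrite map_inj_in_uniq ?conjugates_uniq // => w1 w2 h1 h2 E.
  by rewrite -(et _ h1) -(et _ h2) E.
- by rewrite size_map size_conjugates_dim gt.
move=> s; split=> [/mapP[w wt ->]|[f ->]].
  by rewrite /e; case: (ext w) => f /= /(_ wt)[].
apply/mapP; exists (f t); first exact: embedding_conj.
have:= embedding_conj f t; rewrite /e; case: (ext _) => g /= h /h[gtE [g' Eg]].
apply/funext => y.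
have /adjoin1_polyP[p Ep] : y \in <<1; t>>%VS by rewrite gt memvf.
by rewrite Ep rmorph_horner_rat Eg rmorph_horner_rat -Eg gtE.
Qed.

Definition embs := sval embeddings_seq.

Lemma embs_uniq : uniq embs.
Proof. by rewrite /embs; case: embeddings_seq => r []. Qed.

Lemma size_embs : size embs = \dim {: F}.
Proof. by rewrite /embs; case: embeddings_seq => r []. Qed.

Lemma embsP s : s \in embs <-> exists f : {rmorphism F -> C}, s = f.
Proof. by rewrite /embs; case: embeddings_seq => r /= [_ _] /(_ s). Qed.

(** Embeddings that agree on Q(x) are determined by the image of a primitive
    element, and these images are all roots of one and the same polynomial: the
    minimal polynomial over Q(x), transported along the common restriction. *)
Lemma fiber_le x w :
  (count_mem w [seq s x | s <- embs] <= \dim_(<<1; x>>%AS) {: F})%N.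
Proof.
have [t gt] := primitive_element.
set K := <<1; x>>%AS; set g := minPoly K t.
have gKt : <<K; t>>%VS = fullv.
  by apply/eqP; rewrite eqEsubv subvf /= -gt sub_adjoin1v memv_adjoin.
rewrite count_map -size_filter.
set r := filter _ _.
have rP s : s \in r -> s x = w /\ exists f : {rmorphism F -> C}, s = f.
  by rewrite mem_filter /= => /andP[/eqP-> /embsP].
have ur : uniq r by rewrite filter_uniq ?embs_uniq.
case Er: r => [//|s0 r']; have /rP[s0x [f0 Ef0]] : s0 \in r by rewrite Er mem_head.
rewrite -Er -(size_map (fun s => s t)).
have -> : \dim_K {: F} = (size (map_poly f0 g)).-1.
  by rewrite size_map_poly size_minPoly adjoin_degreeE gKt.
rewrite -ltnS prednK ?lt0n ?size_poly_eq0 ?map_poly_eq0; last first.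
  by rewrite monic_neq0 ?monic_minPoly.
apply: max_poly_roots.
- by rewrite map_poly_eq0 monic_neq0 ?monic_minPoly.
- apply/allP => _ /mapP[s /rP[sx [f Ef]] ->].
  suff <- : map_poly f g = map_poly f0 g.
    by rewrite Ef fmorph_root root_minPoly.
  apply/polyP => i; rewrite !coef_map.
  have /adjoin1_polyP[p Ep] := polyOverP (minPolyOver K t) i.
  by rewrite /= /g Ep !rmorph_horner_rat -Ef -Ef0 sx s0x.
rewrite map_inj_in_uniq // => s1 s2 /rP[_ [f1 ->]] /rP[_ [f2 ->]] E.
apply/funext => y; have /adjoin1_polyP[p Ep] : y \in <<1; t>>%VS by rewrite gt memvf.
by rewrite Ep !rmorph_horner_rat E.
Qed.

(** The values at [x] of all embeddings are the conjugates of [x], each taken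
    [F : Q(x)] times.  The upper bound [fiber_le] on every multiplicity suffices,
    since the total [F : Q] leaves no room for a smaller one; no extension of
    embeddings from Q(x) to [F] has to be constructed. *)
Lemma perm_embs x : perm_eq [seq s x | s <- embs]
  (flatten (nseq (\dim_(<<1; x>>%AS) {: F}) (conjugates C (phi x)))).
Proof.
set m := \dim_ _ _; set c := conjugates C (phi x).
have dimE : \dim {: F} = (m * size c)%N.
  by rewrite /c size_conjugates_dim -dim_sup_field ?subvf.
have sub : {subset [seq s x | s <- embs] <= c}.
  by move=> _ /mapP[s /embsP[f ->] ->]; exact: embedding_conj.
have countE w : w \in c -> count_mem w [seq s x | s <- embs] = m.
  move=> wc; apply/eqP; rewrite eqn_leq fiber_le /=.
  have := sum_count_mem (conjugates_uniq C _) sub.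
  rewrite size_map size_embs dimE (bigD1_seq w) ?conjugates_uniq //=.
  rewrite [X in _ = X]mulnC -[X in _ = X]sum_nat_const_seq.
  rewrite (bigD1_seq w) ?conjugates_uniq //= => E.
  rewrite -(leq_add2r (\sum_(i <- c | i != w) m)) -E leq_add2l.
  by apply: leq_sum => v _; apply: fiber_le.
apply/allP => w _ /=; rewrite count_flatten map_nseq sumn_nseq.
rewrite (count_uniq_mem _ (conjugates_uniq C _)) mulnC.
have [/countE->|wc] := boolP (w \in c); first by rewrite muln1.
by rewrite muln0; apply/eqP/count_memPn; apply: contra wc => /sub.
Qed.

End Embeddings.

(** * Norms and means over conjugates *)

Section NormsAndMeans.
Variable C : numClosedFieldType.

Definition conj_mean (a : algC) (h : C -> C) : C :=
  (size (conjugates C a))%:R^-1 * \sum_(w <- conjugates C a) h w.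

Lemma prod_conjugates_int a : a \in Aint ->
  exists m : int, \prod_(w <- conjugates C a) w = m%:~R.
Proof.
move=> aA; have := coef0_prod_XsubC (conjugates C a).
rewrite -conjugatesE coef_map /= => /(canLR (signrMK _)) <-.
have /intrP[m ->] : (rat_minpoly a)`_0 \in Num.int.
  by rewrite -Cint_rat -(coef_map (ratr : rat -> algC)) -rat_minpolyE (polyOverP aA).
rewrite ratr_int; exists ((-1) ^+ size (conjugates C a) * m).
by rewrite rmorphM rmorph_sign.
Qed.

Lemma AGM_seq (r : seq C) : (0 < size r)%N -> {in r, forall z, 0 <= z} ->
  1 <= \prod_(z <- r) z -> 1 <= (size r)%:R^-1 * \sum_(z <- r) z.
Proof.
move=> r_gt0 r_ge0; rewrite !(big_tnth _ _ r) => le1.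
have ge0 i : i \in 'I_(size r) -> 0 <= tnth (in_tuple r) i.
  by move=> _; rewrite r_ge0 ?mem_tnth.
have [] := leif_AGM ge0; rewrite card_ord => /(le_trans le1) + _.
rewrite mulrC expr_ge1 //.
by rewrite mulr_ge0 ?invr_ge0 ?ler0n ?sumr_ge0.
Qed.

Variables (F : fieldExtType rat) (phi : {rmorphism F -> algC}).
Local Notation embs := (embs C phi).

Lemma prod_embsM x y : \prod_(s <- embs) s (x * y) =
  (\prod_(s <- embs) s x) * \prod_(s <- embs) s y.
Proof.
rewrite -big_split; apply: eq_big_seq => s /embsP[f ->].
by rewrite rmorphM.
Qed.

Lemma prod_embsX x n : \prod_(s <- embs) s (x ^+ n) = (\prod_(s <- embs) s x) ^+ n.
Proof.
rewrite -prodrXl; apply: eq_big_seq => s /embsP[f ->].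
by rewrite rmorphXn.
Qed.

Lemma prod_embs_neq0 x : x != 0 -> \prod_(s <- embs) s x != 0.
Proof.
move=> x0; rewrite prodf_seq_neq0; apply/allP => s /embsP[f ->] /=.
by rewrite fmorph_eq0.
Qed.

Lemma prod_embs_int x : phi x \in Aint ->
  exists m : int, \prod_(s <- embs) s x = m%:~R.
Proof.
move=> xA; rewrite -(big_map (fun s : F -> C => s x) xpredT id).
rewrite (perm_big _ (perm_embs _ _ x)) big_flatten big_nseq.
have [m ->] := prod_conjugates_int xA.
by exists (m ^+ \dim_(<<1; x>>%AS) {: F}); rewrite iter_mulr_1 rmorphXn.
Qed.

(** Normalised sums over embeddings do not depend on the ambient field. *)
Lemma conj_mean_embs x (h : C -> C) :
  (\dim {: F})%:R^-1 * \sum_(s <- embs) h (s x) = conj_mean (phi x) h.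
Proof.
have dimE := dim_sup_field (subvf <<1; x>>%AS).
have dim_gt0 : (0 < \dim {: F})%N by rewrite adim_gt0.
move: (\dim_ _ _) dimE (perm_embs C phi x) => m.
rewrite -(size_conjugates_dim C phi) => dimE permE.
have m_gt0 : (0 < m)%N by move: dim_gt0; rewrite dimE muln_gt0 => /andP[].
rewrite -(big_map (fun s : F -> C => s x) xpredT h) (perm_big _ permE).
rewrite big_flatten big_nseq iter_addr_0 dimE.
rewrite -[_ *+ m]mulr_natl natrM invfM mulrACA mulVf ?mul1r //.
by rewrite pnatr_eq0 -lt0n.
Qed.

(** The geometric mean of the [`|s x| ^+ 2] is a power of the absolute value of
    the norm of [x], a nonzero integer. *)
Lemma mean_sq_ge1 x : x != 0 -> phi x \in Aint ->
  1 <= (\dim {: F})%:R^-1 * \sum_(s <- embs) `|s x| ^+ 2.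
Proof.
move=> x0 xA; rewrite -(size_embs C phi).
rewrite -(big_map (fun s : F -> C => `|s x| ^+ 2) xpredT id).
rewrite -(size_map (fun s : F -> C => `|s x| ^+ 2) embs).
apply: AGM_seq; first by rewrite size_map size_embs adim_gt0.
  by move=> _ /mapP[s _ ->]; rewrite exprn_ge0.
rewrite big_map prodrXl -normr_prod exprn_ege1 //.
have := prod_embs_neq0 x0; have [m ->] := prod_embs_int xA.
by rewrite intr_eq0 -intr_norm ler1z -gtz0_ge1 normr_gt0.
Qed.

End NormsAndMeans.

(** * The inner product and the square-norm *)

Section Inner.
Variable R : realType.
Local Notation C := R[i].

Lemma Qadjoin2_embedding a b : {phi : {rmorphism Qadjoin2 a b -> algC} |
  phi (Qadjoin2_fst a b) = a & phi (Qadjoin2_snd a b) = b}.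
Proof.
rewrite /Qadjoin2_fst /Qadjoin2_snd /Qadjoin2.
case: num_field_exists => Qs [phi] /= [s1 /= E _].
exists phi; first by rewrite -[RHS]/([:: a; b]`_0) -E (nth_map 0) // -(size_map phi) E.
by rewrite -[RHS]/([:: a; b]`_1) -E (nth_map 0) // -(size_map phi) E.
Qed.

(** The square-norm [<a, a>], in the form that involves the conjugates of [a]
    only and not an auxiliary field. *)
Definition sq_norm (a : algC) : C := conj_mean a (fun w => `|w| ^+ 2).

Lemma innerE a b (phi : {rmorphism Qadjoin2 a b -> algC}) :
  inner R a b = (\dim {: Qadjoin2 a b})%:R^-1 *
    \sum_(s <- embs C phi) s (Qadjoin2_fst a b) * Num.conj (s (Qadjoin2_snd a b)).
Proof.
rewrite /inner; congr (_ * _); rewrite [RHS]fsbig_seq ?embs_uniq //.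
suff -> : embeddings R (Qadjoin2 a b) = [set` embs C phi]%classic by [].
by apply/seteqP; split => s /= /embsP.
Qed.

(** When [b] is a function of [a] that is compatible with embeddings (in
    practice a rational function of [a]), their inner product is a mean over
    the conjugates of [a] alone. *)
Lemma inner_conj_mean_l a b (g : C -> C) :
  (forall s : {rmorphism Qadjoin2 a b -> C},
     s (Qadjoin2_snd a b) = g (s (Qadjoin2_fst a b))) ->
  inner R a b = conj_mean a (fun w => w * Num.conj (g w)).
Proof.
move=> sg; have [phi Ea Eb] := Qadjoin2_embedding a b.
rewrite (innerE phi) -[in RHS]Ea -conj_mean_embs; congr (_ * _).
by apply: eq_big_seq => s /embsP[f ->]; rewrite sg.
Qed.

Lemma inner_conj_mean_r a b (g : C -> C) :
  (forall s : {rmorphism Qadjoin2 a b -> C},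
     s (Qadjoin2_fst a b) = g (s (Qadjoin2_snd a b))) ->
  inner R a b = conj_mean b (fun w => g w * Num.conj w).
Proof.
move=> sg; have [phi Ea Eb] := Qadjoin2_embedding a b.
rewrite (innerE phi) -[in RHS]Eb -conj_mean_embs; congr (_ * _).
by apply: eq_big_seq => s /embsP[f ->]; rewrite sg.
Qed.

(** All three square-norms are computed in Q(a, b); the hypothesis kills the
    cross term, and its complex conjugate kills the other one. *)
Lemma sq_normD a b : inner R a b = 0 -> sq_norm (a + b) = sq_norm a + sq_norm b.
Proof.
have [phi Ea Eb] := Qadjoin2_embedding a b.
rewrite (innerE phi) => ab0.
set x := Qadjoin2_fst a b in Ea ab0 *; set y := Qadjoin2_snd a b in Eb ab0 *.
have sqE z : sq_norm (phi z) =
    (\dim {: Qadjoin2 a b})%:R^-1 * \sum_(s <- embs C phi) `|s z| ^+ 2.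
  by rewrite (conj_mean_embs _ _ (fun w => `|w| ^+ 2)).
have -> : a + b = phi (x + y) by rewrite rmorphD Ea Eb.
have -> : sq_norm a = sq_norm (phi x) by rewrite Ea.
have -> : sq_norm b = sq_norm (phi y) by rewrite Eb.
rewrite !sqE.
have ba0 : (\dim {: Qadjoin2 a b})%:R^-1 *
    \sum_(s <- embs C phi) s y * Num.conj (s x) = 0.
  have := congr1 Num.conj ab0; rewrite rmorphM rmorph0 fmorphV rmorph_nat.
  move=> ab0'; rewrite -[RHS]ab0' rmorph_sum; congr (_ * _).
  by apply: eq_bigr => s _; rewrite rmorphM /= conjCK mulrC.
rewrite -mulrDr -big_split /=.
rewrite -[RHS]addr0 -[X in _ = _ + X]ab0 -[RHS]addr0 -[X in _ = _ + X]ba0.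
rewrite -!mulrDr -!big_split /=; congr (_ * _).
apply: eq_big_seq => s /embsP[f ->]; rewrite !normCK rmorphD rmorphD /=.
by ring.
Qed.

Lemma sq_norm_ge1 a : a \in Aint -> a != 0 -> 1 <= sq_norm a.
Proof.
have [phi Ea _] := Qadjoin2_embedding a a.
rewrite /sq_norm -Ea fmorph_eq0 -conj_mean_embs => aA a0.
exact: mean_sq_ge1.
Qed.

End Inner.
(** * Bounding the roots of a polynomial by its coefficients *)

Section SchurInequality.
Variable C : numClosedFieldType.
Local Notation adj M := (map_mx Num.conj (M^T)).

(** Both sides are the square of the Frobenius norm. *)
Lemma mxtrace_mul_adj n (A : 'M[C]_n) :
  \tr (A *m adj A) = \sum_i \sum_j `|A i j| ^+ 2.
Proof.
apply: eq_bigr => i _; rewrite mxE; apply: eq_bigr => j _.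
by rewrite !mxE normCK.
Qed.

Lemma unitarymx_adjK m n (P : 'M[C]_n) (B : 'M[C]_(n, m)) : P \is unitarymx ->
  adj P *m (P *m B) = B.
Proof. by move=> /unitarymxP/mulmx1C PP; rewrite mulmxA PP mul1mx. Qed.

Lemma char_poly_conj n (A P Q : 'M[C]_n) : P *m Q = 1%:M ->
  char_poly (P *m A *m Q) = char_poly A.
Proof.
move=> PQ; rewrite /char_poly.
have PQ' : map_mx polyC P *m map_mx polyC Q = 1%:M by rewrite -map_mxM PQ map_mx1.
have -> : char_poly_mx (P *m A *m Q) =
    map_mx polyC P *m char_poly_mx A *m map_mx polyC Q.
  rewrite /char_poly_mx mulmxBr mulmxBl !map_mxM scalar_mxC -!mulmxA PQ'.
  by rewrite mulmx1 !mulmxA.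
by rewrite !det_mulmx mulrAC -det_mulmx PQ' det1 mul1r.
Qed.

(** A unitary change of basis preserves the Frobenius norm and makes the matrix
    triangular, with the eigenvalues on the diagonal. *)
Lemma Schur_inequality n (A : 'M[C]_n) (r : seq C) :
  char_poly A = \prod_(z <- r) ('X - z%:P) ->
  \sum_(z <- r) `|z| ^+ 2 <= \sum_i \sum_j `|A i j| ^+ 2.
Proof.
move=> Er.
have [n0|n_gt0] := posnP n.
  have : size (char_poly A) = (size r).+1 by rewrite Er size_prod_XsubC.
  rewrite size_char_poly => -[sr]; rewrite (size0nil (etrans (esym sr) n0)) big_nil.
  by apply: sumr_ge0 => i _; apply: sumr_ge0 => j _; rewrite exprn_ge0.
have [P Pu] := Schur A n_gt0; rewrite /similar_to /= conjymx //.
set T := P *m A *m _ => Ttrig.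
have permT : perm_eq r [seq T i i | i <- enum 'I_n].
  apply: prod_XsubC_eq.
  by rewrite -Er -(char_poly_conj A (unitarymxP Pu)) -/T char_poly_trig // big_map big_enum.
rewrite (perm_big _ permT) big_map big_enum /= -mxtrace_mul_adj.
have -> : \tr (A *m adj A) = \tr (T *m adj T).
  have adjK (M : 'M[C]_n) : adj (adj M) = M.
    by apply/matrixP => i j; rewrite !mxE conjCK.
  have -> : adj T = P *m adj A *m adj P.
    by rewrite /T !trmx_mul !map_mxM /= adjK mulmxA.
  have -> : T *m (P *m adj A *m adj P) = P *m (A *m adj A) *m adj P.
    by rewrite /T -!(@mulmxA C) (unitarymx_adjK _ Pu).
  by rewrite [RHS]mxtrace_mulC (unitarymx_adjK _ Pu).
rewrite mxtrace_mul_adj; apply: ler_sum => i _.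
rewrite (bigD1 i) //= lerDl; apply: sumr_ge0 => j _.
by rewrite exprn_ge0.
Qed.

Lemma sum_sq_roots_le (p : {poly C}) (r : seq C) :
  p = \prod_(z <- r) ('X - z%:P) -> (0 < size r)%N ->
  \sum_(z <- r) `|z| ^+ 2 <= (size r).-1%:R + \sum_(j < size r) `|p`_j| ^+ 2.
Proof.
move=> Ep r_gt0.
have sp : (size p).-1 = size r by rewrite Ep size_prod_XsubC.
have mp : p \is monic by rewrite Ep monic_prod_XsubC.
have := @Schur_inequality _ (companionmx p) r; rewrite companionmxK // -Ep.
move=> /(_ erefl)/le_trans; apply.
rewrite -sp; rewrite -sp in r_gt0.
have lt_last : ((size p).-2 < (size p).-1)%N by rewrite prednK.
rewrite (bigD1 (Ordinal lt_last)) //= addrC lerD //.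
  rewrite (eq_bigr (fun=> 1)).
    rewrite sumr_const cardC1 card_ord //.
  move=> i ni; have ni' : (i == (size p).-2 :> nat) = false := negPf ni.
  have lti : (i.+1 < (size p).-1)%N.
    rewrite ltn_neqAle ltn_ord andbT; apply: contra_neq ni => Ei.
    by apply: val_inj; apply: (congr1 predn Ei).
  rewrite (bigD1 (Ordinal lti)) //= big1 ?addr0.
    by rewrite mxE /= ni' eqxx normr1 expr1n.
  move=> j nj; rewrite mxE ni' /= eq_sym.
  by move: nj; rewrite -val_eqE /= => /negPf->; rewrite normr0 expr0n.
by apply: ler_sum => j _; rewrite mxE /= eqxx normrN.
Qed.

End SchurInequality.
(** * The auxiliary trinomial *)

Section Trinomial.
Variable C : numClosedFieldType.
Implicit Types (n : nat) (a w : C).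

Definition trinomial n a : {poly C} := 'X^n - (2 * (1 + a)) *: 'X^(n.-1) - 2%:P.

Definition trinomial_roots n a : seq C :=
  sval (closed_field_poly_normal (trinomial n a)).

Lemma size_trinomial n a : (1 < n)%N -> size (trinomial n a) = n.+1.
Proof.
case: n => [|[|n]] // _; rewrite /trinomial /= -addrA size_polyDl size_polyXn //.
apply: (leq_ltn_trans (size_polyD _ _)); rewrite !size_polyN gtn_max ltnS.
apply/andP; split; first by rewrite (leq_trans (size_scale_leq _ _)) ?size_polyXn.
by rewrite (leq_ltn_trans (size_polyC_leq1 _)).
Qed.

Lemma trinomial_monic n a : (1 < n)%N -> trinomial n a \is monic.
Proof.
move=> n_gt1; rewrite monicE lead_coefE size_trinomial //= !coefB coefXn eqxx.
case: n n_gt1 => [|[|n]] // _; rewrite coefZ coefXn coefC /=.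
by rewrite gtn_eqF // mulr0 !subr0.
Qed.

Lemma trinomialE n a : (1 < n)%N ->
  trinomial n a = \prod_(w <- trinomial_roots n a) ('X - w%:P).
Proof.
move=> n_gt1; rewrite /trinomial_roots; case: closed_field_poly_normal => r /= {1}->.
by rewrite (monicP _) ?trinomial_monic ?scale1r.
Qed.

Lemma size_trinomial_roots n a : (1 < n)%N -> size (trinomial_roots n a) = n.
Proof.
move=> n_gt1; have := size_trinomial a n_gt1.
by rewrite trinomialE // size_prod_XsubC => -[].
Qed.

Lemma mem_trinomial_roots n a w : (1 < n)%N ->
  (w \in trinomial_roots n a) = (w ^+ n == 2 * (1 + a) * w ^+ n.-1 + 2).
Proof.
move=> n_gt1; rewrite -root_prod_XsubC -trinomialE // /root.
rewrite /trinomial hornerD hornerN hornerD hornerN hornerZ !hornerXn hornerC.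
by rewrite subr_eq0 subr_eq [2 + _]addrC.
Qed.

Lemma sum_trinomial_roots n a : (1 < n)%N ->
  \sum_(w <- trinomial_roots n a) w = 2 * (1 + a).
Proof.
move=> n_gt1; apply: oppr_inj.
rewrite -coefPn_prod_XsubC ?size_trinomial_roots -?trinomialE -?lt0n ?(ltnW n_gt1) //.
case: n n_gt1 => [|[|n]] // _; rewrite !coefB coefZ !coefXn coefC /= eqxx.
by rewrite ltn_eqF // mulr1 sub0r subr0.
Qed.

Lemma sum_sq_trinomial_roots n a : (1 < n)%N ->
  \sum_(w <- trinomial_roots n a) `|w| ^+ 2 <= n%:R + (4 * `|1 + a| ^+ 2 + 4).
Proof.
move=> n_gt1; have := sum_sq_roots_le (trinomialE a n_gt1).
rewrite size_trinomial_roots // => /(_ (ltnW n_gt1))/le_trans; apply.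
apply: lerD; first by rewrite ler_nat leq_pred.
case: n n_gt1 => [|[|n]] // _; rewrite big_ord_recl big_ord_recr /= big1; last first.
  move=> i _; rewrite /trinomial !coefB coefZ !coefXn coefC /= /bump /= add1n !eqSS.
  rewrite (ltn_eqF (ltn_ord i)) (ltn_eqF (leqW (ltn_ord i))).
  by rewrite mulr0 !subr0 normr0 expr0n.
rewrite /trinomial !coefB !coefZ !coefXn !coefC /= /bump /= add1n eqxx (ltn_eqF (ltnSn _)).
rewrite !mulr0 mulr1 !subr0 !sub0r !normrN add0r normrM exprMn.
by rewrite normr_nat -natrX addrC.
Qed.

End Trinomial.

(** A root of the trinomial determines [a] rationally; in particular [a] lies in
    every field that contains the root. *)
Lemma trinomial_solve (K : fieldType) n (w a : K) : (2 : K) != 0 -> (1 < n)%N ->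
  w ^+ n = 2 * (1 + a) * w ^+ n.-1 + 2 ->
  a = (w ^+ n - 2) / (2 * w ^+ n.-1) - 1.
Proof.
move=> nz2 n_gt1 E.
have w0 : w != 0.
  apply: contra_eq_neq E => ->; rewrite !expr0n; case: n n_gt1 => [|[|n]] //= _.
  by rewrite mulr0 add0r eq_sym.
have wn0 : w ^+ n.-1 != 0 by rewrite expf_neq0.
rewrite E addrK; move: (w ^+ n.-1) wn0 => x x0.
by field; rewrite x0 nz2.
Qed.

(** Put [t = g b^(n-1)] and [u = 1 + t].  Then [(- t)^n = (- g)^n (2u)^(n-1)] is a
    multiple of [u] because [n > 1], and so is [1 - (- t)^n], because
    [1 - (- t) = u].  Hence [u] divides [1]. *)
Lemma Aint_trinomial_unit n (b g : algC) : b \in Aint -> g \in Aint -> (1 < n)%N ->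
  b ^+ n = 2 * (1 + g * b ^+ n.-1) ->
  exists2 v, v \in Aint & (1 + g * b ^+ n.-1) * v = 1.
Proof.
move=> bA gA; case: n => [|[|n]] //= _.
set t := g * _ => E.
have tA : t \in Aint by rewrite rpredM ?rpredX.
have uA : 1 + t \in Aint by rewrite rpredD ?rpred1.
exists (\sum_(i < n.+2) (- t) ^+ i + (- g) ^+ n.+2 * 2 ^+ n.+1 * (1 + t) ^+ n).
  apply: rpredD; first by apply: rpred_sum => i _; rewrite rpredX ?rpredN.
  apply: rpredM; last exact: rpredX.
  by apply: rpredM; apply: rpredX; rewrite ?rpredN // rpred_nat.
have geom x k : (1 - x) * (\sum_(i < k) x ^+ i) = 1 - x ^+ k :> algC.
  by rewrite -[RHS]opprB subrX1 -mulNr opprB.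
rewrite mulrDr -[X in (1 + X) * _]opprK geom.
have -> : (- t) ^+ n.+2 = (- g) ^+ n.+2 * (2 * (1 + t)) ^+ n.+1.
  by rewrite -E -exprM mulnC exprM -exprMn /t mulNr.
rewrite exprMn [(1 + t) ^+ n.+1]exprS; ring.
Qed.

Lemma Aint_root_monic (p : {poly algC}) x : p \is monic -> root p x ->
  {in (p : seq algC), forall c, c \in Aint} -> x \in Aint.
Proof.
move=> mp rp pA.
have [|q mq rq] := @integral_root_monic int algC intr x p mp rp.
  move=> c /pA cA; have /floorpP[q Eq] := cA.
  exists q; last by rewrite -Eq root_minCpoly.
  have := minCpoly_monic c; rewrite Eq !monicE.
  rewrite lead_coef_map_inj //; last exact: intr_inj.
  by rewrite (inj_eq intr_inj (lead_coef q) 1).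
apply: root_monic_Aint rq _ _; first exact: monic_map.
by apply/polyOverP => i; rewrite coef_map /= rpred_int.
Qed.
Lemma rmorph_trinomial (K L : fieldType) (f : {rmorphism K -> L}) n (a w : K) :
  (f w ^+ n == 2 * (1 + f a) * f w ^+ n.-1 + 2) =
  (w ^+ n == 2 * (1 + a) * w ^+ n.-1 + 2).
Proof.
rewrite -[RHS](inj_eq (fmorph_inj f)).
by rewrite !(rmorphXn, rmorphD, rmorphM, rmorph1, rmorph_nat).
Qed.

Section TrinomialRootDegree.
Variable C : numClosedFieldType.

(** Since [b^n] is [2] times a unit, norms from [F] to Q give
    [N(b)^n = 2^[F : Q]] up to sign; compare the exponents of [2]. *)
Lemma degree_trinomial_root (F : fieldExtType rat) (phi : {rmorphism F -> algC})
    (a b : F) n : prime n -> phi a \in Aint -> phi b \in Aint ->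
  b ^+ n = 2 * (1 + a) * b ^+ n.-1 + 2 -> (n %| \dim {: F})%N.
Proof.
move=> n_pr aA bA E; have n_gt1 := prime_gt1 n_pr.
set u := 1 + (1 + a) * b ^+ n.-1.
have Eu : b ^+ n = 2 * u by rewrite E /u; move: (b ^+ n.-1) => x; ring.
have uA : phi u \in Aint.
  rewrite /u rmorphD rmorph1 rmorphM rmorphD rmorph1 rmorphXn.
  by rewrite rpredD ?rpredM ?rpredX ?rpredD.
have [v vA uv] : exists2 v, phi v \in Aint & u * v = 1.
  have gA : 1 + phi a \in Aint by rewrite rpredD.
  have Eb : phi b ^+ n = 2 * (1 + (1 + phi a) * phi b ^+ n.-1).
    rewrite -rmorphXn Eu /u.
    by rewrite !(rmorphM, rmorphD, rmorph1, rmorphXn, rmorph_nat).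
  have [v vA Ev] := Aint_trinomial_unit bA gA n_gt1 Eb.
  have Eu' : phi u = 1 + (1 + phi a) * phi b ^+ n.-1.
    by rewrite /u !(rmorphM, rmorphD, rmorph1, rmorphXn).
  have u0 : u != 0.
    rewrite -(fmorph_eq0 phi) Eu'; apply/eqP => u0; move/eqP: Ev.
    by rewrite u0 mul0r eq_sym oner_eq0.
  exists u^-1; last by rewrite divff.
  rewrite fmorphV; suff -> : (phi u)^-1 = v by [].
  by rewrite -[RHS](mulKf (_ : phi u != 0)) ?fmorph_eq0 // Eu' Ev mulr1.
have [k Ek] := prod_embs_int C bA.
have [m Em] := prod_embs_int C uA.
have [l El] := prod_embs_int C vA.
have ml : m * l = 1.
  apply: (@intr_inj C); rewrite intrM -Em -El -prod_embsM uv.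
  by rewrite big1_seq // => s /andP[_ /embsP[f ->]]; rewrite rmorph1.
have kn : k ^+ n = 2 ^+ \dim {: F} * m.
  apply: (@intr_inj C); rewrite intrM [LHS]rmorphXn /= -Ek -Em -prod_embsX Eu prod_embsM.
  congr (_ * _); rewrite [RHS]rmorphXn /= -(size_embs C phi).
  rewrite (eq_big_seq (fun=> 2)); last by move=> s /embsP[f ->]; rewrite rmorph_nat.
  by rewrite big_const_seq count_predT iter_mulr_1.
have m1 : `|m|%N = 1%N.
  by have := congr1 absz ml; rewrite abszM => /eqP; rewrite muln_eq1 => /andP[/eqP].
have : (`|k| ^ n)%N = (2 ^ \dim {: F})%N.
  by have := congr1 absz kn; rewrite abszX abszM m1 muln1 abszX.
move=> /(congr1 (logn 2)); rewrite lognX pfactorK // => <-.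
exact: dvdn_mulr.
Qed.

(** Every conjugate of [b] is a root of the trinomial of some conjugate of [a].
    There are at most [n * deg a] such roots, while [deg b] is a multiple of the
    coprime numbers [n] and [deg a]. *)
Lemma conjugates_trinomial_root n (a b : algC) : prime n ->
  (size (conjugates C a) < n)%N -> a \in Aint -> b \in Aint ->
  b ^+ n = 2 * (1 + a) * b ^+ n.-1 + 2 ->
  perm_eq (conjugates C b)
    (flatten [seq trinomial_roots n w | w <- conjugates C a]).
Proof.
move=> n_pr d_lt_n aA bA E; have n_gt1 := prime_gt1 n_pr.
have [F [phi [[|b' [|//]] // [Eb] gen]]] := num_field_exists [:: b].
rewrite adjoin_seq1 in gen.
pose a' : F := (b' ^+ n - 2) / (2 * b' ^+ n.-1) - 1.
have Ea : phi a' = a.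
  rewrite [RHS](trinomial_solve _ n_gt1 E) ?pnatr_eq0 // -Eb /a'.
  by rewrite rmorphB fmorph_div rmorphB rmorphM !rmorphXn rmorph_nat rmorph1.
have E' : b' ^+ n = 2 * (1 + a') * b' ^+ n.-1 + 2.
  by apply/eqP; rewrite -(rmorph_trinomial phi) Ea Eb; apply/eqP.
have sizeb : size (conjugates C b) = \dim {: F}.
  by rewrite -Eb size_conjugates_dim gen.
have sizea : (size (conjugates C a) %| size (conjugates C b))%N.
  by rewrite sizeb -Ea size_conjugates_dim field_dimS ?subvf.
have sizen : (n %| size (conjugates C b))%N.
  rewrite sizeb.
  by apply: (degree_trinomial_root (phi := phi) n_pr _ _ E'); rewrite ?Ea ?Eb.
have size_le : (size (conjugates C a) * n <= size (conjugates C b))%N.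
  apply: dvdn_leq; first exact: size_conjugates_gt0.
  rewrite Gauss_dvd ?sizea // coprime_sym prime_coprime //.
  by rewrite gtnNdvd ?size_conjugates_gt0.
set s := flatten _.
have size_s : size s = (size (conjugates C a) * n)%N.
  rewrite size_flatten /shape -map_comp sumnE big_map.
  under eq_bigr do rewrite /= size_trinomial_roots //.
  by rewrite sum_nat_const_seq.
have sub : {subset conjugates C b <= s}.
  move=> w; rewrite -Eb => /(embedding_exists gen)[f <-].
  apply/flatten_mapP; exists (f a'); first by rewrite -Ea embedding_conj.
  by rewrite mem_trinomial_roots // rmorph_trinomial E'.
have ub := conjugates_uniq C b.
have size_le' : (size s <= size (conjugates C b))%N by rewrite size_s.
have [_ eqs] := uniq_min_size ub sub size_le'.
by apply: uniq_perm => //; apply: leq_size_uniq ub sub size_le'.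
Qed.

End TrinomialRootDegree.

(** * An integer of small norm connecting two orthogonal integers *)

Section ConnectingInteger.
Variable R : realType.
Local Notation C := R[i].

Lemma natr_upper_bound (z : C) : 0 <= z -> exists N : nat, z <= N%:R.
Proof.
move=> z_ge0; have [x Ex] : exists x : R, z = x%:C%C.
  by exists (complex.Re z); rewrite RRe_real // ger0_real.
rewrite Ex ler0c in z_ge0 *; exists (Num.bound x).
by rewrite -(rmorph_nat (real_complex R)) lecR ltW // archi_boundP.
Qed.

Lemma conj_mean_conj a (h : C -> C) :
  conj_mean a (fun w => Num.conj (h w)) = Num.conj (conj_mean a h).
Proof. by rewrite /conj_mean rmorphM fmorphV rmorph_nat rmorph_sum. Qed.

Lemma inner_one_r a : inner R a 1 = conj_mean a id.
Proof.
rewrite (inner_conj_mean_l (g := fun=> 1)).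
  by congr (_ * _); apply: eq_bigr => w _; rewrite rmorph1 mulr1.
move=> s; have [phi _ E1] := Qadjoin2_embedding a 1.
suff -> : Qadjoin2_snd a 1 = 1 by rewrite rmorph1.
by apply: (fmorph_inj phi); rewrite E1 rmorph1.
Qed.

Lemma inner_one_l a : inner R 1 a = Num.conj (conj_mean a id).
Proof.
rewrite -conj_mean_conj (inner_conj_mean_r (g := fun=> 1)).
  by congr (_ * _); apply: eq_bigr => w _; rewrite mul1r.
move=> s; have [phi E1 _] := Qadjoin2_embedding 1 a.
suff -> : Qadjoin2_fst 1 a = 1 by rewrite rmorph1.
by apply: (fmorph_inj phi); rewrite E1 rmorph1.
Qed.

Section TrinomialRoot.
Variables (n : nat) (a b : algC).
Hypotheses (n_gt1 : (1 < n)%N) (Eb : b ^+ n = 2 * (1 + a) * b ^+ n.-1 + 2).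
Let g (w : C) := (w ^+ n - 2) / (2 * w ^+ n.-1) - 1.

Lemma inner_trinomial_l : inner R b a = conj_mean b (fun w => w * Num.conj (g w)).
Proof.
apply: inner_conj_mean_l => s; apply: trinomial_solve => //.
  by rewrite pnatr_eq0.
apply/eqP; rewrite rmorph_trinomial.
have [phi E1 E2] := Qadjoin2_embedding b a.
by rewrite -(rmorph_trinomial phi) E1 E2 Eb.
Qed.

Lemma inner_trinomial_r :
  inner R a b = Num.conj (conj_mean b (fun w => w * Num.conj (g w))).
Proof.
rewrite -conj_mean_conj (inner_conj_mean_r (g := g)).
  by congr (_ * _); apply: eq_bigr => w _; rewrite rmorphM /= conjCK mulrC.
move=> s; apply: trinomial_solve => //; first by rewrite pnatr_eq0.
apply/eqP; rewrite rmorph_trinomial.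
have [phi E1 E2] := Qadjoin2_embedding a b.
by rewrite -(rmorph_trinomial phi) E1 E2 Eb.
Qed.

Hypotheses (aA : a \in Aint) (bA : b \in Aint).
Hypotheses (n_pr : prime n) (n_gt : (size (conjugates C a) < n)%N).

Lemma conj_mean_trinomial (h : C -> C) :
  conj_mean b h = (size (conjugates C a) * n)%:R^-1 *
    \sum_(z <- conjugates C a) \sum_(w <- trinomial_roots n z) h w.
Proof.
have P := conjugates_trinomial_root n_pr n_gt aA bA Eb.
rewrite /conj_mean (perm_size P) (perm_big _ P) big_flatten big_map.
congr ((_%:R)^-1 * _).
rewrite size_flatten /shape -map_comp sumnE big_map.
under eq_bigr do rewrite /= size_trinomial_roots //.
by rewrite sum_nat_const_seq.
Qed.

Hypothesis tr0 : conj_mean a (@id C) = 0.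

Lemma sum_conjugates_eq0 : \sum_(z <- conjugates C a) z = 0.
Proof.
apply/eqP; have /eqP := tr0; rewrite mulf_eq0 invr_eq0 pnatr_eq0.
by rewrite gtn_eqF ?size_conjugates_gt0.
Qed.

(** Up to a positive factor the mean is the sum of the [2 * (1 + z)] over the
    conjugates [z] of [a], which is twice the degree of [a]. *)
Lemma trace_trinomial_neq0 : conj_mean b (@id C) != 0.
Proof.
rewrite conj_mean_trinomial mulf_neq0 ?invr_eq0 ?pnatr_eq0 //.
  by rewrite muln_eq0 negb_or -!lt0n size_conjugates_gt0 ltnW.
under eq_bigr do rewrite sum_trinomial_roots //.
rewrite -mulr_sumr big_split /= sum_conjugates_eq0 addr0 big_const_seq count_predT.
rewrite iter_addr_0 mulf_neq0 ?pnatr_eq0 // -lt0n.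
exact: size_conjugates_gt0.
Qed.

(** On the roots of the trinomial of [z] the function [g] is constantly [z], so
    up to a positive factor the mean is the sum of the
    [2 * (1 + z) * Num.conj z]; the [Num.conj z] sum to zero with the trace of
    [a], and what remains is a positive multiple of the square-norm of [a]. *)
Lemma pairing_trinomial_neq0 : a != 0 ->
  conj_mean b (fun w => w * Num.conj (g w)) != 0.
Proof.
move=> a0; rewrite conj_mean_trinomial mulf_neq0 ?invr_eq0 ?pnatr_eq0 //.
  by rewrite muln_eq0 negb_or -!lt0n size_conjugates_gt0 ltnW.
rewrite (eq_bigr (fun z => 2 * (Num.conj z + `|z| ^+ 2))); last first.
  move=> z _; rewrite (eq_big_seq (fun w => w * Num.conj z)).
    by rewrite -mulr_suml sum_trinomial_roots // normCK; ring.
  move=> w; rewrite mem_trinomial_roots // => /eqP Ew.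
  by rewrite /g -(trinomial_solve _ n_gt1 Ew) ?pnatr_eq0.
rewrite -mulr_sumr big_split /= -rmorph_sum sum_conjugates_eq0 rmorph0 add0r.
rewrite mulf_neq0 ?pnatr_eq0 //.
have := sq_norm_ge1 R aA a0; apply: contraTneq.
by rewrite /sq_norm /conj_mean => ->; rewrite mulr0 ler10.
Qed.

Lemma sq_norm_trinomial_lt2 :
  \sum_(z <- conjugates C a) (4 * `|1 + z| ^+ 2 + 4) < n%:R ->
  sq_norm R b < 2.
Proof.
move=> bound; rewrite /sq_norm conj_mean_trinomial.
have d_gt0 := size_conjugates_gt0 C a.
have dn_gt0 : (0 < size (conjugates C a) * n)%N by rewrite muln_gt0 d_gt0 ltnW.
rewrite ltr_pdivrMl ?ltr0n //.
apply: (@le_lt_trans _ _ (\sum_(z <- conjugates C a) (n%:R + (4 * `|1 + z| ^+ 2 + 4)))).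
  by apply: ler_sum => z _; apply: sum_sq_trinomial_roots.
rewrite big_split /= big_const_seq count_predT iter_addr_0.
apply: (@lt_le_trans _ _ (n%:R *+ size (conjugates C a) + n%:R)).
  by rewrite ltrD2l.
rewrite -mulrnA -natrD -natrM ler_nat.
by rewrite muln2 -addnn mulnC leq_add2l leq_pmull.
Qed.

End TrinomialRoot.

Lemma exists_trinomial_root n (a : algC) : (1 < n)%N -> a \in Aint ->
  exists2 b, b \in Aint & b ^+ n = 2 * (1 + a) * b ^+ n.-1 + 2.
Proof.
move=> n_gt1 aA.
have [b rb] : exists b, root (trinomial n a) b.
  by apply/closed_rootP; rewrite size_trinomial // eqSS -lt0n ltnW.
exists b; last first.
  apply/eqP; rewrite -mem_trinomial_roots // -root_prod_XsubC.
  by rewrite -trinomialE.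
apply: Aint_root_monic rb _; first exact: trinomial_monic.
suff /polyOverP pA : trinomial n a \is a polyOver Aint.
  by move=> c /(nthP 0)[i _ <-].
rewrite rpredB ?polyOverC ?rpred_nat // rpredB ?polyOverXn //.
by rewrite polyOverZ ?polyOverXn // rpredM ?rpredD ?rpred_nat.
Qed.

(** The hypothesis on the mean says that [a] has trace zero, that is, [a] is
    orthogonal to [1]. *)
Lemma connecting_integer (a : algC) : a \in Aint -> a != 0 ->
  conj_mean a (@id C) = 0 ->
  exists b, [/\ b \in Aint, sq_norm R b < 2, conj_mean b (@id C) != 0,
    inner R b a != 0 & inner R a b != 0].
Proof.
move=> aA a0 tr0.
have [|N leN] := @natr_upper_bound (\sum_(z <- conjugates C a) (4 * `|1 + z| ^+ 2 + 4)).
  by apply: sumr_ge0 => z _; rewrite addr_ge0 ?mulr_ge0 ?exprn_ge0 ?ler0n.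
(* [n > N] brings the square-norm of the root below 2; [n > deg a] makes its
   degree equal to [n * deg a]. *)
have [n] := prime_above (maxn N (size (conjugates C a))).
rewrite gtn_max => /andP[N_lt d_lt] n_pr.
have n_gt1 := prime_gt1 n_pr.
have [b bA Eb] := exists_trinomial_root n_gt1 aA.
have pair := pairing_trinomial_neq0 n_gt1 Eb aA bA n_pr d_lt tr0 a0.
exists b; split => //.
- apply: (sq_norm_trinomial_lt2 n_gt1 Eb) => //.
  by apply: le_lt_trans leN _; rewrite ltr_nat.
- exact: (trace_trinomial_neq0 n_gt1 Eb).
- by rewrite (inner_trinomial_l n_gt1 Eb).
- by rewrite (inner_trinomial_r n_gt1 Eb) fmorph_eq0.
Qed.

(** Two nonzero orthogonal components would each contribute at least [1] to the
    square-norm. *)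
Lemma small_in_summand (L1 L2 : zmodClosed Zbar) (x : Zbar) :
  orthogonal_subgroups (fun x y : Zbar => inner R (Zbar_val x) (Zbar_val y)) L1 L2 ->
  bijective (@sum_map _ L1 L2) -> sq_norm R (Zbar_val x) < 2 ->
  x \in L1 \/ x \in L2.
Proof.
move=> orth [f _ fK] lt2.
have [y1 [y2 [y1L y2L Ex]]] : exists y1 y2, [/\ y1 \in L1, y2 \in L2 & x = y1 + y2].
  exists (val (f x).1), (val (f x).2).
  by split; [exact: valP | exact: valP | rewrite -[LHS]fK].
have [y10|y10] := eqVneq y1 0; first by right; rewrite Ex y10 add0r.
have [y20|y20] := eqVneq y2 0; first by left; rewrite Ex y20 addr0.
have ge1 (y : Zbar) : y != 0 -> 1 <= sq_norm R (Zbar_val y).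
  by case: y => y yA y0; apply: sq_norm_ge1.
move: lt2; rewrite Ex [Zbar_val _]/= sq_normD; last exact: orth.
by move=> /lt_geF; rewrite -[2]/(1 + 1) lerD ?ge1.
Qed.

Lemma conjugates1 w : w \in conjugates C 1 -> w = 1.
Proof.
have dv : rat_minpoly 1 %| 'X - 1%:P.
  by rewrite -root_rat_minpoly map_polyXsubC rmorph1 root_XsubC.
rewrite mem_conjugates => rw; have : root (QtoF ('X - 1%:P)) w.
  by apply: root_dvdp rw; rewrite dvdp_map.
by rewrite map_polyXsubC /= rmorph1 root_XsubC => /eqP.
Qed.

Lemma sq_norm1 : sq_norm R 1 = 1.
Proof.
rewrite /sq_norm /conj_mean (eq_big_seq (fun=> 1)); last first.
  by move=> w /conjugates1->; rewrite normr1 expr1n.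
rewrite big_const_seq count_predT iter_addr_0 mulVf // pnatr_eq0 -lt0n.
exact: size_conjugates_gt0.
Qed.

Definition Zbar1 : Zbar := MkZbar (rpred1 Aint).

(** Orthogonality is assumed in one of the two orders only, so that the lemma
    applies with the two summands in either role. *)
Lemma trivial_if_orthogonal_to_one (L1 L2 : zmodClosed Zbar) (x : Zbar) :
    (forall y, sq_norm R (Zbar_val y) < 2 -> y \in L1 \/ y \in L2) ->
    (forall y z, y \in L1 -> z \in L2 ->
      inner R (Zbar_val y) (Zbar_val z) = 0 \/
      inner R (Zbar_val z) (Zbar_val y) = 0) ->
  Zbar1 \in L1 -> x \in L2 -> x = 0.
Proof.
move=> split orth oneL xL; apply/eqP; apply: contraT => x0.
have conj_mean0 z : z \in L2 -> conj_mean (Zbar_val z) (@id C) = 0.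
  move=> /(orth _ _ oneL); rewrite inner_one_l inner_one_r.
  by case=> // /eqP; rewrite fmorph_eq0 => /eqP.
have xA : Zbar_val x \in Aint by case: (x).
have x0' : Zbar_val x != 0 by rewrite -[0]/(Zbar_val 0) (inj_eq val_inj).
have [b [bA b2 btr bx xb]] := connecting_integer xA x0' (conj_mean0 x xL).
have [bL|/conj_mean0/eqP] := split (MkZbar bA) b2; last by rewrite (negPf btr).
by have [/eqP|/eqP] := orth _ _ bL xL; rewrite ?(negPf bx) ?(negPf xb).
Qed.

End ConnectingInteger.

Theorem theorem1p1 (R : realType) :
  indecomposable (fun x y : Zbar => inner R (Zbar_val x) (Zbar_val y)).
Proof.
split.
  by exists Zbar1; rewrite -(inj_eq val_inj) oner_eq0.
move=> L1 L2 orth bij.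
have small_split y := small_in_summand (x := y) orth bij.
have [|oneL|oneL] := small_split Zbar1; first by rewrite sq_norm1 ltr1n.
  right=> x xL; apply: (trivial_if_orthogonal_to_one small_split _ oneL xL).
  by move=> y z yL zL; left; apply: orth.
left=> x xL; apply: (@trivial_if_orthogonal_to_one R L2 L1 x _ _ oneL xL).
  by move=> y /small_split []; [right | left].
by move=> y z yL zL; right; apply: orth.
Qed.
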